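(* Let $T,W\in M^{m\times n}(\mathbb{C})$ be such that $\mathcal{R}(W)\subseteq\mathcal{R}(T)$ and let $\mathcal{M}$ be a subspace of $\mathbb{C}^n$ such that $\mathcal{M}\overset{.}{+}\mathcal{N}(T)=\mathbb{C}^n$. Let $T=U-V$ be a proper splitting of $T$, and consider the iterative process $$X^{i+1}=Y_{\mathcal{M}}X^{i}+Z_{\mathcal{M}},$$ where $Y_{\mathcal{M}},Z_{\mathcal{M}}\in M^n(\mathbb{C})$ are the reduced solutions for $\mathcal{M}$ of $UY=V$ and $UZ=W$, respectively. Then the following assertions hold: (a) If $WT^*\in M^m_H(\mathbb{C})$ and $\rho(Y_{\mathcal{M}})<1$, then the iterative process converges to a Hermitian reduced solution of $TX=W$ if and only if $\mathcal{R}(W^* )\subseteq\mathcal{M}$. (b) If $WT^*\in M^m_+(\mathbb{C})$, $r(WT^* )=r(W)$ and $\rho(Y_{\mathcal{M}})<1$, then the iterative process converges to a positive semidefinite reduced solution of $TX=W$ if and only if $\mathcal{R}(W^* )\subseteq\mathcal{M}$.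
   Context: $M^{m\times n}(\mathbb{C})$ denotes the complex $m\times n$ matrices, $M^n(\mathbb{C})=M^{n\times n}(\mathbb{C})$, $M^n_H(\mathbb{C})$ the Hermitian matrices and $M^n_+(\mathbb{C})$ the positive semidefinite matrices in $M^n(\mathbb{C})$ (i.e. $\langle Ax,x\rangle\ge 0$ for all $x\in\mathbb{C}^n$); $\mathcal{R}(\cdot)$, $\mathcal{N}(\cdot)$, $r(\cdot)$, $\rho(\cdot)$ denote range, nullspace, rank and spectral radius; $\overset{.}{+}$ denotes direct sum of subspaces. Proper splitting: a decomposition $T=U-V$ with $U,V\in M^{m\times n}(\mathbb{C})$ is a proper splitting of $T\in M^{m\times n}(\mathbb{C})$ if $\mathcal{R}(U)=\mathcal{R}(T)$ and $\mathcal{N}(U)=\mathcal{N}(T)$. In that case $\mathcal{R}(V)\subseteq\mathcal{R}(T)$ and $\mathcal{N}(T)\subseteq\mathcal{N}(V)$. Reduced solution: if $A,B\in M^{m\times n}(\mathbb{C})$, $\mathcal{R}(B)\subseteq\mathcal{R}(A)$ and $\mathcal{M}\overset{.}{+}\mathcal{N}(A)=\mathbb{C}^n$, there is a unique $X_{\mathcal{M}}\in M^{n}(\mathbb{C})$ with $AX_{\mathcal{M}}=B$ and $\mathcal{R}(X_{\mathcal{M}})\subseteq\mathcal{M}$; it is called the reduced solution for $\mathcal{M}$ of $AX=B$. ''A reduced solution of $AX=B$'' means the reduced solution for some complement $\mathcal{M}$ of $\mathcal{N}(A)$. When $\rho(Y_{\mathcal{M}})<1$, the iterative process converges for every initial $X^0$,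 to a limit independent of $X^0$. *)

(* Defs.v *)
From HB Require Import structures.
From mathcomp Require Import all_boot all_order all_algebra complex.
From mathcomp Require Import all_classical all_reals all_analysis.

Set Implicit Arguments.
Unset Strict Implicit.
Unset Printing Implicit Defensive.

Import Order.TTheory GRing.Theory Num.Theory.
Import numFieldNormedType.Exports.

Local Open Scope classical_set_scope.
Local Open Scope ring_scope.
Local Open Scope sesquilinear_scope.

(* The topology of the modulus on R[i].  The library attaches it only to R[i]^o
   and to abstract numFieldTypes; with this instance 'M[R[i]]_(m, n) gets the
   topology of entrywise convergence. *)
HB.instance Definition _ (R : realType) :=
  PseudoPointedMetric.copy R[i] R[i]^o.
HB.instance Definition _ (R : realType) :=
  NormedModule.copy R[i] R[i]^o.

Section MatrixNotions.
Context {R : realType}.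
Local Notation C := R[i].
Implicit Types m n : nat.

(* Matrices act on column vectors; the subspaces of mxalgebra are row spaces. *)
Definition range_space m n (A : 'M[C]_(m, n)) : {vspace 'cV[C]_m} :=
  limg (linfun (mulmx A : 'cV[C]_n -> 'cV[C]_m)).

Definition null_space m n (A : 'M[C]_(m, n)) : {vspace 'cV[C]_n} :=
  lker (linfun (mulmx A : 'cV[C]_n -> 'cV[C]_m)).

Definition complementary n (M N : {vspace 'cV[C]_n}) : Prop :=
  directv (M + N) /\ (M + N)%VS = fullv.

Definition inner n (x y : 'cV[C]_n) : C := \sum_i x i 0 * (y i 0)^*.

(* In R[i], 0 <= z means that z is real and nonnegative. *)
Definition possemidef n (A : 'M[C]_n) : Prop :=
  forall x : 'cV[C]_n, 0 <= inner (A *m x) x.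

(* The norm of a complex number is itself complex, with zero imaginary part;
   sup set0 = 0 when n = 0. *)
Definition spectral_radius n (A : 'M[C]_n) : R :=
  sup [set complex.Re `|a| | a in [set a : C | eigenvalue A a]].

Definition proper_splitting m n (T U V : 'M[C]_(m, n)) : Prop :=
  [/\ T = U - V, range_space U = range_space T & null_space U = null_space T].

Definition reduced_solution_for m n (M : {vspace 'cV[C]_n})
    (A B : 'M[C]_(m, n)) (X : 'M[C]_n) : Prop :=
  [/\ complementary M (null_space A), A *m X = B & (range_space X <= M)%VS].

Definition reduced_solution m n (A B : 'M[C]_(m, n)) (X : 'M[C]_n) : Prop :=
  exists M : {vspace 'cV[C]_n}, reduced_solution_for M A B X.

End MatrixNotions.

(* Main.v *)
(* Since rho(Y) < 1, the matrix I - Y is invertible and the process converges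
   to the fixed point L = (I - Y)^-1 Z: the error satisfies E(k+1) = Y E(k), and
   splitting the characteristic polynomial of Y into linear factors reduces its
   decay to scalar recurrences u(k+1) = z u(k) + o(1) with |z| < 1.  Multiplying
   L = Y L + Z by U shows that L is the reduced solution for M of T X = W.

   Write A' for the adjoint of A.  If L is Hermitian then W' = L T', so R(W')
   lies in R(L), hence in M.  Conversely, if W T' is Hermitian and R(W') lies in M,
   then T (L T' - W') = 0 with L T' - W' ranging in M, so L T' = W'; taking
   adjoints, T (L - L') = 0, and L = K W makes L - L' range in M as well, so
   L = L'. *)

Require Import Defs.
From HB Require Import structures.
From mathcomp Require Import all_boot all_order all_algebra complex.
From mathcomp Require Import all_classical all_reals all_analysis.
From mathcomp Require Import lra.

Set Implicit Arguments.
Unset Strict Implicit.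
Unset Printing Implicit Defensive.

Import Order.TTheory GRing.Theory Num.Theory.
Import numFieldNormedType.Exports.

Local Open Scope classical_set_scope.
Local Open Scope ring_scope.
Local Open Scope sesquilinear_scope.

(** * Scalar recurrences with a vanishing forcing term *)

Lemma cvg0_affine_recurrence (R : realType) (q : R) (a e : nat -> R) :
  0 <= q < 1 -> (forall k, 0 <= a k) ->
  (forall k, a k.+1 <= q * a k + e k) ->
  e @ \oo --> (0 : R) -> a @ \oo --> (0 : R).
Proof.
move=> /andP[q0 q1] a0 ha /cvgr0Pnorm_le he.
apply/cvgr0Pnorm_le => eps eps0.
(* With this tolerance on [e], [eps / 2] is a fixed point of the bounding recurrence: [q * (eps / 2)
   + eps / 2 * (1 - q) = eps / 2]. *)
have d0 : 0 < eps / 2 * (1 - q) by rewrite mulr_gt0 ?subr_gt0// divr_gt0.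
have [N _ hN] := he _ d0.
have bnd j : a (j + N)%N <= q ^+ j * a N + eps / 2.
  elim: j => [|j IH]; first by rewrite expr0 mul1r lerDl ltW// divr_gt0.
  rewrite addSn; apply: le_trans (ha _) _.
  have : `|e (j + N)%N| <= eps / 2 * (1 - q).
    by apply: hN; rewrite /= leq_addl.
  move=> /(le_trans (ler_norm _)) ej.
  have := ler_wpM2l q0 IH; rewrite exprS; move: ej.
  lra.
have /cvgr0Pnorm_le : geometric (a N) q @ \oo --> (0 : R).
  by apply: cvg_geometric; rewrite ger0_norm.
move=> /(_ _ (divr_gt0 eps0 (ltr0n _ 2))) [K _ hK].
exists (K + N)%N => // k /= hk.
have hN' : (N <= k)%N by apply: leq_trans hk; rewrite leq_addl.
rewrite ger0_norm// -(subnK hN'); apply: le_trans (bnd _) _.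
rewrite [leRHS](splitr eps) lerD2r mulrC.
apply: le_trans (ler_norm _) (hK _ _) => /=.
by rewrite leq_subRL// addnC.
Qed.

(** A positive element of [R[i]] has zero imaginary part, so tolerances in [R] and in [R[i]]
    correspond. *)
Lemma complex_cvg0P (R : realType) (u : nat -> R[i]) :
  u @ \oo --> (0 : R[i]) <-> (fun k => complex.Re `|u k|) @ \oo --> (0 : R).
Proof.
split.
  move/cvgr0Pnorm_le => hu; apply/cvgr0Pnorm_le => eps eps0.
  have e0 : 0 < (eps%:C)%C :> R[i] by rewrite ltcR.
  apply: filterS (hu _ e0) => k; rewrite normc_def lecR /= => h.
  by rewrite ger0_norm ?sqrtr_ge0.
move/cvgr0Pnorm_le => hu; apply/cvgr0Pnorm_le => eps eps0.
have [d d0 ->] : exists2 d : R, 0 < d & eps = (d%:C)%C.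
  case: eps eps0 => x y; rewrite ltcE /= => /andP[/eqP -> x0].
  by exists x.
apply: filterS (hu _ d0) => k; rewrite normc_def lecR /= => h.
by rewrite (le_trans (ler_norm _)).
Qed.

Lemma complex_cvg0_affine_recurrence (R : realType) (z : R[i])
    (u : nat -> R[i]) : `|z| < 1 ->
  (fun k => u k.+1 - z * u k) @ \oo --> (0 : R[i]) -> u @ \oo --> (0 : R[i]).
Proof.
move=> z1 /complex_cvg0P hu; apply/complex_cvg0P.
apply: (cvg0_affine_recurrence (q := complex.Re `|z|)) hu.
- have : 0 <= `|z| < 1 by rewrite normr_ge0.
  by rewrite normc_def ltcR lecR.
- by move=> k; rewrite normc_def /= sqrtr_ge0.
- move=> k; rewrite -lecR rmorphD rmorphM /=.
  have E (w : R[i]) : ((complex.Re `|w|)%:C)%C = `|w| by rewrite normc_def.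
  by rewrite !E -normrM addrC; apply: le_trans (ler_normD _ _); rewrite subrK.
Qed.

(** * Entrywise convergence and spectral decay *)

Lemma mx_cvg_entrywise (T : topologicalType) m n (X : nat -> 'M[T]_(m, n))
    (L : 'M[T]_(m, n)) :
  X @ \oo --> L <-> forall i j, (fun k => X k i j) @ \oo --> L i j.
Proof.
split=> [hX i j A hA | hX A [P hP PA]].
  apply: (hX [set N : 'M[T]_(m, n) | A (N i j)]).
  (* A basic neighbourhood constraining only the entry at [i], [j]. *)
  exists (fun i' j' => if (i' == i) && (j' == j) then A else setT).
    move=> i' j'; case: eqP => [->|_]; case: eqP => [->|_] //=;
      exact: filterT.
  by move=> N /(_ i j); rewrite /= !eqxx.
apply: (@filterS _ \oo _ [set k | forall i j, P i j (X k i j)]).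
  by move=> k h; apply: PA.
by do 2!apply: (@filter_forall _ _ _ _ eventually_filter) => ?; apply/hX/hP.
Qed.

Lemma mx_cvg_unique (R : realType) m n (X : nat -> 'M[R[i]]_(m, n))
    (L L' : 'M[R[i]]_(m, n)) : X @ \oo --> L -> X @ \oo --> L' -> L = L'.
Proof.
move=> /mx_cvg_entrywise hL /mx_cvg_entrywise hL'; apply/matrixP => i j.
exact: (cvg_unique (@norm_hausdorff _ R[i]^o) (hL i j) (hL' i j)).
Qed.

(* Peeling off one root [z]: [(Y - z) E] satisfies the same recurrence and is
   annihilated by the remaining factors, and it is the forcing term of
   [E k.+1 = z * E k + (Y - z) E k]. *)
Lemma cvg0_annihilated (R : realType) n p (Y : 'M[R[i]]_n.+1) (s : seq R[i])
    (E : nat -> 'M[R[i]]_(n.+1, p)) :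
  (forall z, z \in s -> `|z| < 1) ->
  (forall k, E k.+1 = Y *m E k) ->
  horner_mx Y (\prod_(z <- s) ('X - z%:P)) *m E 0%N = 0 ->
  forall i j, (fun k => E k i j) @ \oo --> (0 : R[i]).
Proof.
elim: s E => [|z s IH] E hs hE.
  rewrite big_nil rmorph1 mul1mx => E0 i j.
  rewrite (_ : (fun _ => _) = fun=> 0); first exact: cvg_cst.
  apply/funext => k; have -> : E k = 0.
    by elim: k => // k IHk; rewrite hE IHk mulmx0.
  by rewrite mxE.
rewrite big_cons mulrC rmorphM /= rmorphB /= horner_mx_X horner_mx_C.
rewrite -[_ * _]/(_ *m _) -mulmxA => h0 i j.
apply: (complex_cvg0_affine_recurrence (hs z (mem_head _ _))).
have := IH (fun k => (Y - z%:M) *m E k) _ _ h0 i j.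
rewrite (_ : (fun k => ((Y - z%:M) *m E k) i j) =
  fun k => E k.+1 i j - z * E k i j); last first.
  by apply/funext => k; rewrite hE mulmxBl mul_scalar_mx !mxE.
apply; first by move=> w ws; apply: hs; rewrite inE ws orbT.
by move=> k; rewrite hE !mulmxA mulmxBl mulmxBr mul_scalar_mx mul_mx_scalar.
Qed.

(** The characteristic polynomial splits over [R[i]], its roots are the eigenvalues, and by
    Cayley-Hamilton it annihilates [E 0]. *)
Lemma cvg0_spectral (R : realType) n p (Y : 'M[R[i]]_n)
    (E : nat -> 'M[R[i]]_(n, p)) :
  (forall a, eigenvalue Y a -> `|a| < 1) ->
  (forall k, E k.+1 = Y *m E k) ->
  forall i j, (fun k => E k i j) @ \oo --> (0 : R[i]).
Proof.
case: n => [|n] in Y E * => hY hE; first by case.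
have [s hs] := closed_field_poly_normal (char_poly Y).
rewrite (monicP (char_poly_monic Y)) scale1r in hs.
apply: (cvg0_annihilated (Y := Y) (s := s)) => //.
  by move=> z zs; apply: hY; rewrite eigenvalue_root_char hs root_prod_XsubC.
by rewrite -hs Cayley_Hamilton mul0mx.
Qed.

Lemma spectral_radius_lt1 (R : realType) n (Y : 'M[R[i]]_n) :
  spectral_radius Y < 1 -> forall a, eigenvalue Y a -> `|a| < 1.
Proof.
move=> hY a ha.
suff h : complex.Re `|a| <= spectral_radius Y.
  by have := le_lt_trans h hY; rewrite normc_def ltcR.
apply: ub_le_sup; last exact: (imageP (fun b : R[i] => complex.Re `|b|)).
have [s hs] := closed_field_poly_normal (char_poly Y).
rewrite (monicP (char_poly_monic Y)) scale1r in hs.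
have Re0 (b : R[i]) : 0 <= complex.Re `|b| by rewrite normc_def sqrtr_ge0.
(* [sup] dominates its set only when that set is bounded; the sum of the moduli of all roots is a
   bound. *)
exists (\sum_(z <- s) complex.Re `|z|) => _ [b /= hb <-].
rewrite eigenvalue_root_char hs root_prod_XsubC in hb.
by rewrite (big_rem b) //= lerDl; apply: sumr_ge0 => z _; exact: Re0.
Qed.

(** * Ranges, null spaces, adjoints and quadratic forms *)

Section SubspacesAndAdjoints.
Context {R : realType}.
Local Notation C := R[i].

Lemma range_spaceP m n (A : 'M[C]_(m, n)) (M : {vspace 'cV[C]_m}) :
  (range_space A <= M)%VS <-> forall x, A *m x \in M.
Proof.
split=> [/subvP h x | h].
  by apply: h; rewrite -[A *m x](lfunE (mulmx A)) memv_img ?memvf.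
by apply/subvP => y /memv_imgP [x _ ->]; rewrite lfunE; apply: h.
Qed.

Lemma mem_null_space m n (A : 'M[C]_(m, n)) x :
  (x \in null_space A) = (A *m x == 0).
Proof. by rewrite memv_ker lfunE. Qed.

Lemma mulmx_cV_eq0 m n (A : 'M[C]_(m, n)) :
  (forall x : 'cV_n, A *m x = 0) -> A = 0.
Proof.
move=> h; apply/matrixP => i j.
by have /colP/(_ i) := h (delta_mx j 0); rewrite -colE !mxE.
Qed.

(** This is the uniqueness of reduced solutions: each [A *m x] lies in both [M] and the null space
    of [T], which meet only in 0. *)
Lemma complementary_mulmx0 m n p (T : 'M[C]_(m, n)) (M : {vspace 'cV[C]_n})
    (A : 'M[C]_(n, p)) :
  complementary M (null_space T) -> (range_space A <= M)%VS ->
  T *m A = 0 -> A = 0.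
Proof.
move=> [/directv_addP dMT _] /range_spaceP hA TA.
apply: mulmx_cV_eq0 => x.
apply/eqP; rewrite -memv0 -dMT memv_cap hA mem_null_space /=.
by rewrite mulmxA TA mul0mx.
Qed.

Lemma mulmx_factor m n p (A : 'M[C]_(m, n)) (B : 'M[C]_(p, n)) :
  (forall x : 'cV_n, B *m x = 0 -> A *m x = 0) -> exists K, A = K *m B.
Proof.
(* The columns of [cokermx B] lie in the null space of [B], so [A] kills them too. *)
move=> h; apply/submxP; rewrite submxE; apply/eqP/mulmx_cV_eq0 => x.
by rewrite -mulmxA h// mulmxA mulmx_coker mul0mx.
Qed.

(** If [W *m x = 0], then [L *m x] lies in [M] and is killed by [T]. The factorization places the
    range of the adjoint of [L] inside that of [W^t*]. *)
Lemma reduced_solution_factor m n (T W : 'M[C]_(m, n)) (M : {vspace 'cV[C]_n})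
    (L : 'M[C]_n) :
  reduced_solution_for M T W L -> exists K, L = K *m W.
Proof.
move=> [hM TL /range_spaceP hL]; apply: mulmx_factor => x Wx.
apply: (complementary_mulmx0 hM); last by rewrite mulmxA TL.
by apply/range_spaceP => y; rewrite -mulmxA hL.
Qed.

Lemma trmxC_mul m n p (A : 'M[C]_(m, n)) (B : 'M[C]_(n, p)) :
  (A *m B)^t* = B^t* *m A^t*.
Proof. by rewrite trmx_mul map_mxM. Qed.

Lemma hermsymmxP n (A : 'M[C]_n) : A \is hermsymmx <-> A^t* = A.
Proof.
by split => [/is_hermitianmxP|h]; [|apply/is_hermitianmxP];
  rewrite expr0 scale1r.
Qed.

Lemma innerE n (x y : 'cV[C]_n) : inner x y = (y^t* *m x) 0 0.
Proof. by rewrite mxE; apply: eq_bigr => i _; rewrite !mxE mulrC. Qed.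

Lemma inner_adjoint m n (A : 'M[C]_(m, n)) x y :
  inner (A *m x) y = inner x (A^t* *m y).
Proof. by rewrite !innerE trmxC_mul trmxCK mulmxA. Qed.

Lemma innerC n (x y : 'cV[C]_n) : inner x y = (inner y x)^*.
Proof.
by rewrite /inner rmorph_sum; apply: eq_bigr => i _;
  rewrite rmorphM /= conjCK mulrC.
Qed.

(* Polarization: evaluate the form at [x + y] and at [x + 'i y]. *)
Lemma quadratic_form_eq0 n (A : 'M[C]_n) :
  (forall x, inner (A *m x) x = 0) -> A = 0.
Proof.
move=> h; pose b x y := inner (A *m x) y.
have bxx x : b x x = 0 by exact: h.
have il (x : 'cV[C]_n) c y z : inner (x + c *: y) z = inner x z + c * inner y z.
  by rewrite !innerE mulmxDr -scalemxAr [LHS]mxE [X in _ + X]mxE.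
have bl x c y z : b (x + c *: y) z = b x z + c * b y z.
  by rewrite /b mulmxDr -scalemxAr il.
have br x c y z : b z (x + c *: y) = b z x + c^* * b z y.
  by rewrite /b innerC il rmorphD rmorphM /= -!innerC.
have b0 x y : b x y = 0.
  have E c : c * b y x + c^* * b x y = 0.
    have := bxx (x + c *: y).
    by rewrite br 2!bl !bxx mulr0 add0r addr0.
  have := E 1; rewrite rmorph1 !mul1r => /eqP; rewrite addr_eq0 => /eqP E1.
  have /eqP := E 'i; rewrite conjCi E1 mulrN mulNr -opprD oppr_eq0 -mulr2n.
  by rewrite mulrn_eq0 mulf_eq0 (negPf (neq0Ci _)) /= => /eqP.
apply: mulmx_cV_eq0 => x; apply/colP => i.
have := b0 x (delta_mx i 0); rewrite /b /inner (bigD1 i) //= big1 => [|j ji].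
  by rewrite !mxE !eqxx rmorph1 mulr1 addr0.
by rewrite [delta_mx _ _ _ _]mxE (negPf ji) rmorph0 mulr0.
Qed.

(** Nonnegative values are real, so [A] and its adjoint have the same quadratic form. *)
Lemma possemidef_hermsym n (A : 'M[C]_n) : possemidef A -> A \is hermsymmx.
Proof.
move=> h; apply/hermsymmxP/eqP; rewrite -subr_eq0; apply/eqP.
apply: quadratic_form_eq0 => x.
have : inner (A^t* *m x) x = inner (A *m x) x.
  rewrite (inner_adjoint (A^t*)) trmxCK innerC; apply/CrealP/ger0_real/h.
by rewrite !innerE mulmxBl mulmxBr !mxE => ->; rewrite subrr.
Qed.

End SubspacesAndAdjoints.

(** * Convergence of the iteration *)

Lemma iteration_cvg (R : realType) m n (T W U V : 'M[R[i]]_(m, n))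
    (M : {vspace 'cV[R[i]]_n}) (Y Z : 'M[R[i]]_n) (X : nat -> 'M[R[i]]_n) :
  complementary M (null_space T) -> T = U - V ->
  reduced_solution_for M U V Y -> reduced_solution_for M U W Z ->
  (forall k, X k.+1 = Y *m X k + Z) -> spectral_radius Y < 1 ->
  exists2 L, X @ \oo --> L & reduced_solution_for M T W L.
Proof.
move=> hM TE [_ UY /range_spaceP rY] [_ UZ /range_spaceP rZ] hX.
move=> /spectral_radius_lt1 hY.
(* A nonzero row vector killed by [1%:M - Y] would make 1 an eigenvalue of [Y]. *)
have uY : 1%:M - Y \in unitmx.
  rewrite -row_free_unit -kermx_eq0; apply/rowV0P => v /sub_kermxP.
  rewrite mulmxBr mulmx1 => /eqP; rewrite subr_eq0 => /eqP hv.
  apply/eqP/contraT => v0; have := hY 1; rewrite normr1 ltxx; apply.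
  by apply/eigenvalueP; exists v => //; rewrite scale1r.
pose L := invmx (1%:M - Y) *m Z.
have LE : L = Y *m L + Z.
  by rewrite -[X in _ + X](mulKVmx uY) -/L mulmxBl mul1mx addrC subrK.
exists L; last split => //.
- apply/mx_cvg_entrywise => i j.
  have hE k : X k.+1 - L = Y *m (X k - L).
    by rewrite hX {1}LE mulmxBr opprD addrACA subrr addr0.
  have := cvg0_spectral (E := fun k => X k - L) hY hE i j.
  move=> h; rewrite -[L i j]add0r.
  rewrite (_ : (fun k => X k i j) = fun k => (X k - L) i j + L i j).
    by apply: cvgD h _; exact: cvg_cst.
  by apply/funext => k; rewrite !mxE subrK.
- by rewrite TE mulmxBl {1}LE mulmxDr mulmxA UY UZ [_ + W]addrC addrK.
(* The fixed-point equation writes [L *m x] as a value of [Y] plus a value of [Z], both in [M]. *)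
- by apply/range_spaceP => x; rewrite LE mulmxDl -mulmxA memvD.
Qed.

(** * Hermitian and positive semidefinite reduced solutions *)

Lemma hermitian_solution_range (R : realType) m n (T W : 'M[R[i]]_(m, n))
    (M : {vspace 'cV[R[i]]_n}) (L : 'M[R[i]]_n) :
  reduced_solution_for M T W L -> L \is hermsymmx ->
  (range_space (W^t*) <= M)%VS.
Proof.
move=> [_ <- /range_spaceP hL] /hermsymmxP LE; apply/range_spaceP => x.
by rewrite trmxC_mul LE -mulmxA.
Qed.

Lemma solution_adjoint (R : realType) m n (T W : 'M[R[i]]_(m, n))
    (M : {vspace 'cV[R[i]]_n}) (L : 'M[R[i]]_n) :
  reduced_solution_for M T W L -> W *m T^t* \is hermsymmx ->
  (range_space (W^t*) <= M)%VS -> L *m T^t* = W^t*.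
Proof.
move=> [hM TL /range_spaceP hL] /hermsymmxP hWT /range_spaceP hW.
apply/eqP; rewrite -subr_eq0; apply/eqP; apply: (complementary_mulmx0 hM).
  by apply/range_spaceP => x; rewrite mulmxBl memvB// -mulmxA.
by rewrite mulmxBr mulmxA TL -hWT trmxC_mul trmxCK subrr.
Qed.

Lemma solution_hermitian (R : realType) m n (T W : 'M[R[i]]_(m, n))
    (M : {vspace 'cV[R[i]]_n}) (L : 'M[R[i]]_n) :
  reduced_solution_for M T W L -> W *m T^t* \is hermsymmx ->
  (range_space (W^t*) <= M)%VS -> L \is hermsymmx.
Proof.
move=> hL hWT hW; have LT := solution_adjoint hL hWT hW.
have [K LK] := reduced_solution_factor hL.
move: hL hW => [hM TL /range_spaceP hL] /range_spaceP hW.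
apply/hermsymmxP/eqP; rewrite -subr_eq0; apply/eqP.
apply: (complementary_mulmx0 hM).
  (* The adjoint of [L] is [W^t* *m K^t*], hence ranges in [M]. *)
  by apply/range_spaceP => x; rewrite mulmxBl memvB// LK trmxC_mul -mulmxA.
by rewrite mulmxBr TL -[T]trmxCK -trmxC_mul LT trmxCK subrr.
Qed.

(* Since [L] is Hermitian and factors through [W], every [L z] equals [L T^* x]
   for some [x], so the form of [L] is that of [W T^*] = [T L T^*]. *)
Lemma solution_possemidef (R : realType) m n (T W : 'M[R[i]]_(m, n))
    (M : {vspace 'cV[R[i]]_n}) (L : 'M[R[i]]_n) :
  reduced_solution_for M T W L -> possemidef (W *m T^t*) ->
  (range_space (W^t*) <= M)%VS -> possemidef L.
Proof.
move=> hL pWT hW z; have hWT := possemidef_hermsym pWT.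
have LT := solution_adjoint hL hWT hW.
have /hermsymmxP LE := solution_hermitian hL hWT hW.
have [K LK] := reduced_solution_factor hL; have [_ TL _] := hL.
(* Chosen so that [L *m T^t* *m x = W^t* *m K^t* *m z], which is the adjoint of [L] applied to [z],
   that is [L *m z]. *)
pose x := K^t* *m z.
have Lz : L *m z = L *m (T^t* *m x).
  by rewrite mulmxA LT mulmxA -trmxC_mul -LK LE.
have := pWT x; rewrite -TL -!mulmxA inner_adjoint -Lz.
by rewrite inner_adjoint LE -Lz -{1}LE -inner_adjoint.
Qed.

Theorem corollary5p4 (R : realType) (m n : nat)
    (T W U V : 'M[R[i]]_(m, n)) (M : {vspace 'cV[R[i]]_n})
    (Y Z : 'M[R[i]]_n) (X : nat -> 'M[R[i]]_n)
    (hWT : (range_space W <= range_space T)%VS)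
    (hM : complementary M (null_space T))
    (hsplit : proper_splitting T U V)
    (hY : reduced_solution_for M U V Y)
    (hZ : reduced_solution_for M U W Z)
    (hX : forall i : nat, X i.+1 = Y *m X i + Z) :
  (W *m T^t* \is hermsymmx -> spectral_radius Y < 1 ->
     (exists L : 'M[R[i]]_n,
        [/\ X @ \oo --> L, L \is hermsymmx & reduced_solution T W L]) <->
     (range_space (W^t*) <= M)%VS) /\
  (possemidef (W *m T^t*) -> \rank (W *m T^t*) = \rank W ->
   spectral_radius Y < 1 ->
     (exists L : 'M[R[i]]_n,
        [/\ X @ \oo --> L, possemidef L & reduced_solution T W L]) <->
     (range_space (W^t*) <= M)%VS).
Proof.
have [TE _ _] := hsplit.
split=> [hWTs | pWT _] rhoY;
  have [L XL hL] := iteration_cvg hM TE hY hZ hX rhoY; split.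
(* The complement hidden in [reduced_solution] may differ from [M]; uniqueness of the limit turns
   [L'] into [L], which is a reduced solution for [M] itself. *)
- case=> L' [XL' hL' _]; rewrite -(mx_cvg_unique XL XL') in hL'.
  exact: hermitian_solution_range hL hL'.
- move=> hW; exists L; split=> //; last by exists M.
  exact: solution_hermitian hL hWTs hW.
- case=> L' [XL' hL' _]; rewrite -(mx_cvg_unique XL XL') in hL'.
  exact: hermitian_solution_range hL (possemidef_hermsym hL').
- move=> hW; exists L; split=> //; last by exists M.
  exact: solution_possemidef hL pWT hW.
Qed.
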